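(* A connected, skeletal finite EI category $\mathcal{C}$ is a finite free EI category if and only if it satisfies the Unique Factorization Property (UFP).
   Context: A finite EI category is a small category with finitely many morphisms in which every endomorphism is an isomorphism. It is skeletal if isomorphic objects are equal, and connected if any two objects are joined by a finite chain of objects in which consecutive ones have a morphism between them in some direction. Composition is from right to left. A finite EI quiver is a datum $\hat Q=(Q_0,Q_1,s,t,f,g)$ where $(Q_0,Q_1,s,t)$ is a finite acyclic quiver, $f$ assigns a finite group $f(v)$ to each vertex $v$, and $g$ assigns an $(f(t(\alpha)),f(s(\alpha)))$-biset to each arrow $\alpha$. It generates a category $\mathcal{C}_{\hat Q}$ with object set $Q_0$, $\mathrm{End}(v)=f(v)$, and, for $v\neq w$, $\mathrm{Hom}(v,w)=\bigsqcup_\gamma H_\gamma$ over all directed paths $\gamma$ from $v$ to $w$, where for $\gamma$ the path $v=v_0\xrightarrow{\alpha_1}v_1\to\cdots\xrightarrow{\alpha_n}v_n=w$, $H_\gamma=g(\alpha_n)\times_{f(v_{n-1})}\cdots\times_{f(v_1)}g(\alpha_1)$ (biset product: $X\times_K Y=(X\times Y)/((xk,y)\sim(x,ky))$). Composition is induced by the natural maps $H_{\gamma_2}\times H_{\gamma_1}\to H_{\gamma_2}\times_{f(v)}H_{\gamma_1}=H_{\gamma_2\gamma_1}$ and by the group multiplications and actions. A finite EI category is a finite free EI category if it is isomorphic to some $\mathcal{C}_{\hat Q}$. A morphism $\alpha$ is unfactorizable if it is not an isomorphism and whenever $\alpha=\gamma\beta$, either $\beta$ or $\gamma$ is an isomorphism.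 UFP: whenever a non-isomorphism $\alpha:x\to y$ has two decompositions into unfactorizable morphisms $x=x_0\xrightarrow{\alpha_1}x_1\xrightarrow{\alpha_2}\cdots\xrightarrow{\alpha_m}x_m=y$ and $x=y_0\xrightarrow{\beta_1}y_1\xrightarrow{\beta_2}\cdots\xrightarrow{\beta_n}y_n=y$, then $m=n$, $x_i=y_i$ for all $i$, and there are $h_i\in\mathrm{Aut}_{\mathcal{C}}(x_i)$, $1\le i\le n-1$, such that $\beta_1=h_1\alpha_1$, $\beta_2=h_2\alpha_2h_1^{-1}$, ..., $\beta_{n-1}=h_{n-1}\alpha_{n-1}h_{n-2}^{-1}$, $\beta_n=\alpha_nh_{n-1}^{-1}$. *)

(* Defs.v *)
From HB Require Import structures.
From mathcomp Require Import all_boot all_fingroup.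
From mathcomp Require Import generic_quotient.
From mathcomp Require Import boolp classical_sets cardinality.
From Stdlib Require Import Relation_Operators.

Set Implicit Arguments.
Unset Strict Implicit.
Unset Printing Implicit Defensive.

Local Open Scope quotient_scope.

Record category := Category {
  obj :> Type;
  hom : obj -> obj -> Type;
  idm : forall x, hom x x;
  comp : forall x y z, hom y z -> hom x y -> hom x z;
  comp1m : forall x y (a : hom x y), comp (idm y) a = a;
  compm1 : forall x y (a : hom x y), comp a (idm x) = a;
  compA : forall w x y z (c : hom y z) (b : hom x y) (a : hom w x),
    comp c (comp b a) = comp (comp c b) a }.

Arguments idm {c} x : rename.
Arguments comp {c x y z} _ _ : rename.

(* An arrow packed with its endpoints, so that arrows whose endpoints are only
   propositionally equal can be compared. *)
Record mor (C : category) := Mor { dom : C; cod : C; arr : hom dom cod }.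

Arguments Mor {C dom cod} arr.

Section CategoryTheory.
Variable C : category.

Definition inverse_of (x y : C) (a : hom x y) (b : hom y x) : Prop :=
  comp b a = idm x /\ comp a b = idm y.

Definition is_iso (x y : C) (a : hom x y) : Prop :=
  exists b : hom y x, inverse_of a b.

(* The objects are in bijection with the identities, so there are also
   finitely many of them. *)
Definition finite_category : Prop := finite_set [set: mor C].

Definition finite_EI_category : Prop :=
  finite_category /\ forall (x : C) (a : hom x x), is_iso a.

Definition skeletal : Prop :=
  forall (x y : C) (a : hom x y), is_iso a -> x = y.

Definition connected_category : Prop :=
  forall x y : C,
    clos_refl_trans C
      (fun u v => inhabited (hom u v) \/ inhabited (hom v u)) x y.

Definition unfactorizable (x y : C) (a : hom x y) : Prop :=
  ~ is_iso a /\
  forall (z : C) (c : hom z y) (b : hom x z),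
    a = comp c b -> is_iso b \/ is_iso c.

(* [x = x_0 -a_1-> x_1 -> ... -a_m-> x_m = y], with [a_1] at the head. *)
Inductive chain : C -> C -> Type :=
| chain_nil x : chain x x
| chain_cons x z y (a : hom x z) (p : chain z y) : chain x y.

Fixpoint composite x y (p : chain x y) : hom x y :=
  match p in chain x y return hom x y with
  | chain_nil x => idm x
  | chain_cons x z y a p => comp (composite p) a
  end.

Fixpoint all_unfactorizable x y (p : chain x y) : Prop :=
  match p with
  | chain_nil _ => True
  | chain_cons _ _ _ a p => unfactorizable a /\ all_unfactorizable p
  end.

Definition unfactorizable_decomposition x y (a : hom x y) (p : chain x y) :=
  all_unfactorizable p /\ composite p = a.

Record aut (x : C) := Aut {
  autm :> hom x x;
  autV : hom x x;
  aut_inverse : inverse_of autm autV }.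

Definition aut1 (x : C) : aut x :=
  @Aut x (idm x) (idm x) (conj (comp1m (idm x)) (comp1m (idm x))).

(* [aut_related h_0 p q]: the chains [p = (a_1, ..., a_n)] and
   [q = (b_1, ..., b_n)] have the same length and run through the same objects
   [x_0, ..., x_n], and there are automorphisms [h_i] of [x_i], [1 <= i <= n],
   with [h_n = 1] and [b_i = h_i a_i h_(i-1)^-1] for [1 <= i <= n]. *)
Inductive aut_related : forall x y, aut x -> chain x y -> chain x y -> Prop :=
| related_nil x (h : aut x) :
    autm h = idm x -> aut_related h (chain_nil x) (chain_nil x)
| related_cons x z y (h : aut x) (k : aut z) (a b : hom x z)
    (p q : chain z y) :
    b = comp (comp k a) (autV h) ->
    aut_related k p q ->
    aut_related h (chain_cons a p) (chain_cons b q).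

(* Taking [h_0 = 1] turns the first equation into [b_1 = h_1 a_1]. *)
Definition UFP : Prop :=
  forall (x y : C) (a : hom x y) (p q : chain x y),
    ~ is_iso a ->
    unfactorizable_decomposition a p ->
    unfactorizable_decomposition a q ->
    aut_related (aut1 x) p q.

End CategoryTheory.

Record functor (C D : category) := Functor {
  fobj :> C -> D;
  fmap : forall x y, hom x y -> hom (fobj x) (fobj y);
  fmap_id : forall x, fmap (idm x) = idm (fobj x);
  fmap_comp : forall x y z (b : hom y z) (a : hom x y),
    fmap (comp b a) = comp (fmap b) (fmap a) }.

Arguments fmap {C D} f {x y} _.

(* Strict isomorphism: mutually inverse functors.  Equality of packed arrows
   also gives [G (F x) = x] and [F (G x) = x] on objects. *)
Definition isomorphic_categories (C D : category) : Prop :=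
  exists (F : functor C D) (G : functor D C),
    (forall (x y : C) (a : hom x y), Mor (fmap G (fmap F a)) = Mor a) /\
    (forall (x y : D) (a : hom x y), Mor (fmap F (fmap G a)) = Mor a).

Record biset (G H : finGroupType) := Biset {
  bcar :> finType;
  lact : G -> bcar -> bcar;
  ract : bcar -> H -> bcar;
  lact1 : forall x, lact 1%g x = x;
  lactM : forall a b x, lact (a * b)%g x = lact a (lact b x);
  ract1 : forall x, ract x 1%g = x;
  ractM : forall x a b, ract x (a * b)%g = ract (ract x a) b;
  lractA : forall a x b, lact a (ract x b) = ract (lact a x) b }.

Arguments lact {G H b} _ _ : rename.
Arguments ract {G H b} _ _ : rename.

Section BisetProduct.
Variables (G K H : finGroupType) (X : biset G K) (Y : biset K H).

(* [(x k, y) ~ (x, k y)]; since [K] is a group this is already an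
   equivalence relation. *)
Definition balanced : rel (X * Y) := fun u v =>
  [exists k : K, (u.1 == ract v.1 k) && (v.2 == lact k u.2)].

Lemma balancedP u v :
  reflect (exists k : K, u.1 = ract v.1 k /\ v.2 = lact k u.2) (balanced u v).
Proof.
apply: (iffP existsP) => [[k /andP[/eqP e1 /eqP e2]]|[k [e1 e2]]]; exists k => //.
by rewrite e1 e2 !eqxx.
Qed.

Lemma balanced_equiv : equiv_class_of balanced.
Proof.
split=> [u|u v|v u w].
- by apply/balancedP; exists 1%g; rewrite ract1 lact1.
- apply/balancedP/balancedP=> -[k [e1 e2]]; exists k^-1%g.
    by rewrite e1 e2 -ractM -lactM mulgV mulVg ract1 lact1.
  by rewrite e1 e2 -ractM -lactM mulgV mulVg ract1 lact1.
- move=> /balancedP[k [e1 e2]] /balancedP[l [e3 e4]].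
  by apply/balancedP; exists (l * k)%g; rewrite e1 e4 e2 e3 ractM lactM.
Qed.

Canonical balanced_rel := EquivRelPack balanced_equiv.

Definition bprod_car : Type := {eq_quot balanced_rel}.
HB.instance Definition _ := EqQuotient.on bprod_car.
HB.instance Definition _ := Choice.on bprod_car.
HB.instance Definition _ :=
  Countable.copy bprod_car (can_type (@reprK _ bprod_car)).

Fact bprod_enumP :
  Finite.axiom (undup [seq \pi_bprod_car u | u <- enum {: X * Y}]).
Proof.
move=> u; rewrite count_uniq_mem ?undup_uniq// mem_undup.
by rewrite -[u]reprK map_f// mem_enum.
Qed.

HB.instance Definition _ := isFinite.Build bprod_car bprod_enumP.

Definition bclass (x : X) (y : Y) : bprod_car := \pi_bprod_car (x, y).

Lemma bclassP x y x' y' :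
  bclass x y = bclass x' y' <->
  exists k : K, x = ract x' k /\ y' = lact k y.
Proof.
rewrite /bclass; split=> [/eqmodP/balancedP //|exk].
by apply/eqmodP/balancedP.
Qed.

Lemma bclass_repr (u : bprod_car) : bclass (repr u).1 (repr u).2 = u.
Proof. by rewrite /bclass -surjective_pairing reprK. Qed.

Definition bprod_lact (g : G) (u : bprod_car) : bprod_car :=
  bclass (lact g (repr u).1) (repr u).2.

Definition bprod_ract (u : bprod_car) (h : H) : bprod_car :=
  bclass (repr u).1 (ract (repr u).2 h).

Lemma bprod_lactE g x y : bprod_lact g (bclass x y) = bclass (lact g x) y.
Proof.
have /bclassP[k [e1 e2]] := bclass_repr (bclass x y).
by apply/bclassP; exists k; rewrite e1 lractA.
Qed.

Lemma bprod_ractE x y h : bprod_ract (bclass x y) h = bclass x (ract y h).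
Proof.
have /bclassP[k [e1 e2]] := bclass_repr (bclass x y).
by apply/bclassP; exists k; rewrite lractA -e2.
Qed.

Lemma bclass_ind (P : bprod_car -> Prop) :
  (forall x y, P (bclass x y)) -> forall u, P u.
Proof. by move=> IH u; rewrite -(bclass_repr u). Qed.

Fact bprod_lact1 u : bprod_lact 1%g u = u.
Proof. by elim/bclass_ind: u => x y; rewrite bprod_lactE lact1. Qed.

Fact bprod_lactM a b u :
  bprod_lact (a * b)%g u = bprod_lact a (bprod_lact b u).
Proof. by elim/bclass_ind: u => x y; rewrite !bprod_lactE lactM. Qed.

Fact bprod_ract1 u : bprod_ract u 1%g = u.
Proof. by elim/bclass_ind: u => x y; rewrite bprod_ractE ract1. Qed.

Fact bprod_ractM u a b :
  bprod_ract u (a * b)%g = bprod_ract (bprod_ract u a) b.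
Proof. by elim/bclass_ind: u => x y; rewrite !bprod_ractE ractM. Qed.

Fact bprod_lractA a u b :
  bprod_lact a (bprod_ract u b) = bprod_ract (bprod_lact a u) b.
Proof.
by elim/bclass_ind: u => x y; rewrite !(bprod_ractE, bprod_lactE).
Qed.

Definition bprod : biset G H :=
  @Biset G H bprod_car bprod_lact bprod_ract bprod_lact1 bprod_lactM
    bprod_ract1 bprod_ractM bprod_lractA.

End BisetProduct.

Record quiver := Quiver {
  vertex :> finType;
  arrow : finType;
  src : arrow -> vertex;
  tgt : arrow -> vertex }.

(* Directed paths with at least one arrow; [path_cons al p] is [p] followed by
   [al]. *)
Inductive qpath (Q : quiver) : Q -> Q -> Type :=
| path_arrow (al : arrow Q) : qpath (src al) (tgt al)
| path_cons (al : arrow Q) (v : Q) (p : qpath v (src al)) : qpath v (tgt al).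

Arguments path_arrow {Q} al.
Arguments path_cons {Q} al {v} p.

Definition acyclic (Q : quiver) : Prop := forall v : Q, qpath v v -> False.

Record EIquiver := EIQuiver {
  equiver :> quiver;
  vgroup : equiver -> finGroupType;
  abiset : forall al : arrow equiver,
    biset (vgroup (tgt al)) (vgroup (src al));
  equiver_acyclic : acyclic equiver }.

Arguments vgroup {e} _ : rename.
Arguments abiset {e} _ : rename.

Section GeneratedCategory.
Variable Q : EIquiver.

(* [H_gamma = g(al_n) * (g(al_(n-1)) * ( ... * g(al_1)))], the iterated biset
   product bracketed to the right. *)
Fixpoint path_biset (v w : Q) (p : qpath v w) : biset (vgroup w) (vgroup v) :=
  match p in qpath v w return biset (vgroup w) (vgroup v) with
  | path_arrow al => abiset al
  | path_cons al v p => bprod (abiset al) (path_biset p)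
  end.

Fixpoint path_cat (u v w : Q) (p2 : qpath v w) : qpath u v -> qpath u w :=
  match p2 in qpath v w return qpath u v -> qpath u w with
  | path_arrow al => fun p1 => path_cons al p1
  | path_cons al v p2 => fun p1 => path_cons al (path_cat p2 p1)
  end.

(* The natural map [H_p2 * H_p1 -> H_(p2 p1)], [(x, y) |-> [x, y]]; for
   [p2 = al p2'] it sends [([x, z], y)] to [[x, [z, y]]] (see [path_mulE]). *)
Fixpoint path_mul (u v w : Q) (p2 : qpath v w) :
    forall p1 : qpath u v,
      path_biset p2 -> path_biset p1 -> path_biset (path_cat p2 p1) :=
  match p2 as p2' in qpath v w
    return forall p1 : qpath u v,
      path_biset p2' -> path_biset p1 -> path_biset (path_cat p2' p1) with
  | path_arrow al => fun p1 (x : abiset al) (y : path_biset p1) =>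
      bclass x y
  | path_cons al v p2 =>
      fun p1 (x : bprod (abiset al) (path_biset p2)) (y : path_biset p1) =>
      bclass (repr x).1 (path_mul (repr x).2 y)
  end.

Lemma path_mul_lact u v w (p2 : qpath v w) (p1 : qpath u v) k x y :
  path_mul (lact k x) y = lact k (path_mul x y) :> path_biset (path_cat p2 p1).
Proof.
elim: p2 p1 k x y => [al|al v' p2 IH] p1 k x y /=.
  by rewrite bprod_lactE.
rewrite bprod_lactE.
have /bclassP[l [e1 e2]] := bclass_repr (bprod_lact k x).
by apply/bclassP; exists l; rewrite e1 e2 IH.
Qed.

Lemma path_mulE u v al (p2 : qpath v (src al)) (p1 : qpath u v)
    (x : abiset al) (z : path_biset p2) (y : path_biset p1) :
  path_mul (p2 := path_cons al p2) (bclass x z) y = bclass x (path_mul z y).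
Proof.
have /bclassP[l [e1 e2]] := bclass_repr (bclass x z).
by apply/bclassP; exists l; rewrite {2}e2 path_mul_lact.
Qed.

Lemma path_mul_ract u v w (p2 : qpath v w) (p1 : qpath u v) x y k :
  path_mul x (ract y k) = ract (path_mul x y) k :> path_biset (path_cat p2 p1).
Proof.
elim: p2 p1 x y k => [al|al v' p2 IH] p1 x y k /=; rewrite bprod_ractE //.
by rewrite IH.
Qed.

Lemma path_mul_mid u v w (p2 : qpath v w) (p1 : qpath u v) x k y :
  path_mul (ract x k) y = path_mul x (lact k y)
    :> path_biset (path_cat p2 p1).
Proof.
elim: p2 p1 x k y => [al|al v' p2 IH] p1 x k y.
  by apply/bclassP; exists k.
elim/bclass_ind: x => x z.
by rewrite [ract _ _]bprod_ractE !path_mulE IH.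
Qed.

(* As [Q] is acyclic, [End v] consists of the [qend k] only, i.e. is
   [vgroup v], and for [v != w] the morphisms from [v] to [w] are the [qpth x],
   i.e. form the disjoint union of the [H_gamma]; see [qhom_diag] and
   [qhom_offdiag]. *)
Inductive qhom : Q -> Q -> Type :=
| qend (v : Q) (k : vgroup v) : qhom v v
| qpth (v w : Q) (p : qpath v w) (x : path_biset p) : qhom v w.

Definition qid (v : Q) : qhom v v := qend (1%g : vgroup v).

Definition qcomp (u v w : Q) (b : qhom v w) : qhom u v -> qhom u w :=
  match b in qhom v w return qhom u v -> qhom u w with
  | qend v k => fun a =>
      match a in qhom u v return vgroup v -> qhom u v with
      | qend v l => fun k => qend (k * l)%g
      | qpth u v p x => fun k => qpth (lact k x)
      end k
  | qpth v w p2 y => fun a =>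
      match a in qhom u v
        return forall p2 : qpath v w, path_biset p2 -> qhom u w with
      | qend v l => fun p2 y => qpth (ract y l)
      | qpth u v p1 x => fun p2 y => qpth (path_mul y x)
      end p2 y
  end.

Lemma qhom_diag (v : Q) (a : qhom v v) : exists k, a = qend k.
Proof.
suff: forall w (e : w = v) (b : qhom v w),
    exists k, ecast w (qhom v w) e b = qend k by move=> /(_ v erefl a).
move=> w + b; case: b => {v w a} [v k|v w p x] e.
  by rewrite (eq_axiomK e); exists k.
by case: (equiver_acyclic (ecast w (qpath v w) e p)).
Qed.

Lemma qhom_offdiag (v w : Q) (a : qhom v w) :
  v <> w -> exists (p : qpath v w) (x : path_biset p), a = qpth x.
Proof. by case: a => [//|{}v {}w p x] _; exists p, x. Qed.

Lemma qcomp1m u v (a : qhom u v) : qcomp (qid v) a = a.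
Proof. by case: a => [{}v k|{}u {}v p x] /=; rewrite ?mul1g ?lact1. Qed.

Lemma qcompm1 u v (a : qhom u v) : qcomp a (qid u) = a.
Proof. by case: a => [{}v k|{}u {}v p x] /=; rewrite ?mulg1 ?ract1. Qed.

Lemma path_mulA t u v w (p3 : qpath v w) (p2 : qpath u v) (p1 : qpath t u)
    (x : path_biset p3) (y : path_biset p2) (z : path_biset p1) :
  qpth (path_mul x (path_mul y z)) = qpth (path_mul (path_mul x y) z).
Proof.
pose T v w := {p : qpath v w & path_biset p}.
pose tag v w (p : qpath v w) (x : path_biset p) : T v w := existT _ p x.
suff E : tag _ _ _ (path_mul x (path_mul y z))
       = tag _ _ _ (path_mul (path_mul x y) z).
  by rewrite -[LHS]/(let: existT p s := tag _ _ _ _ in qpth s) E.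
elim: p3 p2 x y => [al|al v' p3 IH] p2 x y.
  by rewrite [X in _ = tag _ _ _ X](path_mulE (p2 := p2)).
elim/bclass_ind: x => x s.
have E : path_mul (path_mul (p2 := path_cons al p3) (bclass x s) y) z
         = bclass x (path_mul (path_mul s y) z).
  apply: etrans (path_mulE x (path_mul s y) z).
  exact: (congr1 (fun r : path_biset (path_cons al (path_cat p3 p2)) =>
                    path_mul r z) (path_mulE x s y)).
pose push (m : T t (src al)) : T t (tgt al) :=
  let: existT p s := m in tag _ _ (path_cons al p) (bclass x s).
rewrite E path_mulE; exact: (congr1 push (IH p2 s y)).
Qed.

Lemma qcompA t u v w (c : qhom v w) (b : qhom u v) (a : qhom t u) :
  qcomp c (qcomp b a) = qcomp (qcomp c b) a.
Proof.
case: c b => [? k|? ? p3 x] b.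
  case: b k a => [? l|? ? p2 y] k a.
    by case: a k l => [? m|? ? p1 z] k l /=; rewrite ?mulgA ?lactM.
  by case: a p2 y => [? m|? ? p1 z] p2 y /=;
     rewrite ?lractA ?path_mul_lact.
case: b p3 x a => [? l|? ? p2 y] p3 x a.
  by case: a p3 x l => [? m|? ? p1 z] p3 x l /=;
     rewrite ?ractM ?path_mul_mid.
case: a p2 y => [? m|? ? p1 z] p2 y /=; first by rewrite path_mul_ract.
exact: path_mulA.
Qed.

Definition generated_category : category :=
  @Category Q qhom qid qcomp qcomp1m qcompm1 qcompA.

End GeneratedCategory.

Definition finite_free_EI_category (C : category) : Prop :=
  finite_EI_category C /\
  exists Q : EIquiver, isomorphic_categories C (generated_category Q).

(* Main.v *)
From HB Require Import structures.
From mathcomp Require Import all_boot all_fingroup.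
From mathcomp Require Import generic_quotient.
From mathcomp Require Import boolp classical_sets cardinality.
From Stdlib Require Import Eqdep.
Require Import Defs.

(**
In a generated category, path length is additive and vanishes exactly on
isomorphisms, so an unfactorizable morphism lives on a path of length one.  An
equality [c a = d b] with [a] and [b] unfactorizable then forces
[b = k a] and [c = d k] for an isomorphism [k]: compare the last arrows of the
two sides and induct on the length of [c].  This cancellation property is
invariant under isomorphism of categories and, peeling off one arrow at a time,
gives the UFP.

Conversely, take the quiver on the objects of [C] with one arrow [x -> y]
whenever there are unfactorizable morphisms from [x] to [y], labelled by the
biset of all of them.  Evaluating paths is a functor to [C], the identity on
objects.  It is full because every non-isomorphism of a finite EI category is a
composite of unfactorizables.  A chain of unfactorizables lifts canonically to
the generated category, and lifts of chains related by automorphisms have the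
same composite there, so the UFP makes the functor faithful.
*)

Set Implicit Arguments.
Unset Strict Implicit.
Unset Printing Implicit Defensive.

(** * Isomorphisms and unfactorizable morphisms *)

(** Packed equality becomes equality of dependent pairs, where uniqueness of identity proofs
    ([inj_pair2]) applies. *)
Lemma Mor_inj (C : category) (x y : C) (a b : hom x y) : Mor a = Mor b -> a = b.
Proof.
move=> e.
have: existT (fun u : C * C => hom u.1 u.2) (x, y) a = existT _ (x, y) b.
  exact: (congr1 (fun m : mor C => existT (fun u : C * C => hom u.1 u.2)
                                     (dom m, cod m) (arr m)) e).
exact: inj_pair2.
Qed.

Section Isomorphisms.
Variable C : category.
Implicit Types x y z : C.

Lemma iso_idm x : is_iso (idm x).
Proof. by exists (idm x); split; rewrite comp1m. Qed.

Lemma iso_comp x y z (b : hom y z) (a : hom x y) :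
  is_iso b -> is_iso a -> is_iso (comp b a).
Proof.
move=> [b' [b'b bb']] [a' [a'a aa']]; exists (comp a' b'); split.
  by rewrite -compA (compA b') b'b comp1m.
by rewrite -compA (compA a) aa' comp1m.
Qed.

Lemma iso_inverse x y (a : hom x y) (b : hom y x) : inverse_of a b -> is_iso b.
Proof. by case=> ba ab; exists a. Qed.

Lemma iso_comp_cancell x y z (b : hom y z) (a : hom x y) :
  is_iso b -> is_iso (comp b a) -> is_iso a.
Proof.
move=> [b' hb] ba; have [b'b _] := hb.
by rewrite -[a]comp1m -b'b -compA; apply: iso_comp => //; apply: iso_inverse hb.
Qed.

Lemma iso_comp_cancelr x y z (b : hom y z) (a : hom x y) :
  is_iso a -> is_iso (comp b a) -> is_iso b.
Proof.
move=> [a' ha] ba; have [_ aa'] := ha.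
by rewrite -[b]compm1 -aa' compA; apply: iso_comp => //; apply: iso_inverse ha.
Qed.

Lemma unfactorizable_isol x y z (k : hom y z) (a : hom x y) :
  is_iso k -> unfactorizable a -> unfactorizable (comp k a).
Proof.
move=> isok [nisoa ua]; split; first by move/(iso_comp_cancell isok).
move=> w c b e; have [k' hk] := isok; have [k'k _] := hk.
have /ua[] : a = comp (comp k' c) b by rewrite -compA -e compA k'k comp1m.
  by left.
by move/(iso_comp_cancell (iso_inverse hk)); right.
Qed.

Lemma unfactorizable_isor x y z (a : hom y z) (k : hom x y) :
  is_iso k -> unfactorizable a -> unfactorizable (comp a k).
Proof.
move=> isok [nisoa ua]; split; first by move/(iso_comp_cancelr isok).
move=> w c b e; have [k' hk] := isok; have [_ kk'] := hk.
have /ua[] : a = comp c (comp b k') by rewrite compA -e -compA kk' compm1.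
  by move/(iso_comp_cancelr (iso_inverse hk)); left.
by right.
Qed.

Hypothesis EI : forall x (a : hom x x), is_iso a.

(** With [c] inverse to [b a], the morphism [c b] is a left inverse of [a]. Hence [a c b] is
    idempotent; being an endomorphism it is also invertible, so it is the identity. *)
Lemma EI_split_mono x y (a : hom x y) (b : hom y x) : is_iso a.
Proof.
have [c [cba _]] := EI (comp b a); have [d [_ abcd]] := EI (comp a (comp c b)).
exists (comp c b); split; first by rewrite -compA.
have idem : comp (comp a (comp c b)) (comp a (comp c b)) = comp a (comp c b).
  by rewrite -compA (compA (comp c b)) -(compA c) cba comp1m.
by rewrite -[LHS]compm1 -[in LHS]abcd compA idem abcd.
Qed.

Lemma iso_comp_EI x y z (b : hom y z) (a : hom x y) :
  is_iso (comp b a) -> is_iso a /\ is_iso b.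
Proof.
move=> [c _]; split; first exact: EI_split_mono (comp c b).
exact: EI_split_mono (comp a c).
Qed.

End Isomorphisms.

(** One step of the UFP, phrased without chains and without equality of objects, so that it passes
    easily through an isomorphism of categories. *)
Definition head_cancellation (C : category) : Prop :=
  forall (x z z' y : C) (a : hom x z) (b : hom x z') (c : hom z y)
    (d : hom z' y),
    unfactorizable a -> unfactorizable b -> comp c a = comp d b ->
    exists k : hom z z', [/\ is_iso k, comp k a = b & comp d k = c].

Lemma head_cancellation_UFP (C : category) :
  skeletal C -> (forall (x : C) (a : hom x x), is_iso a) ->
  head_cancellation C -> UFP C.
Proof.
move=> skC EI hc.
(* An arbitrary initial automorphism [h] is allowed so that the induction goes through: the [k]
   found at one step is the [h] of the next. *)
suff rel (x y : C) (p q : chain x y) (h : aut x) :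
    all_unfactorizable p -> all_unfactorizable q ->
    composite p = comp (composite q) h -> aut_related h p q.
  move=> x y a p q _ [up <-] [uq e]; apply: rel => //.
  by rewrite e /= compm1.
(* The cast along [e] permits case analysis on a chain whose two endpoints coincide. A nonempty
   chain is excluded, since in an EI category all factors of an isomorphism are isomorphisms. *)
have nil_case (u v : C) (g : aut u) (r : chain u v) (e : v = u) :
    all_unfactorizable r ->
    idm u = comp (ecast w (hom u w) e (composite r)) g ->
    aut_related g (chain_nil u) (ecast w (chain u w) e r).
  move: g e; case: r => {u v} [u|u w v b r] g e /=.
    rewrite (Prop_irrelevance e erefl) /= comp1m => _ e1.
    exact: related_nil.
  move: b g; subst u => b g /= [[nisob _] _] e1; case: nisob.
  have: is_iso (comp (comp (composite r) b) g) by rewrite -e1; apply: iso_idm.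
  by case/(iso_comp_EI EI) => _ /(iso_comp_EI EI)[].
elim: p q h => {x y} [x|x z y a p IH] q h.
  by move=> _; apply: nil_case erefl.
move: h a p IH; case: q => {x y} [x|x z' y b q] h a p IH /= [ua up].
  move=> _ e; case: ua => nisoa _; case: nisoa.
  have: is_iso (comp (composite p) a).
    by rewrite e comp1m; case: h {e} => h h' hK; exists h'.
  by case/(iso_comp_EI EI).
move=> [ub uq] e; have isoh : is_iso h by exists (autV h); apply: aut_inverse.
(* Cancellation compares [a] with [b h], which is again unfactorizable; skeletality then identifies
   the two intermediate objects. *)
have [k [isok kabh qk]] := hc _ _ _ _ _ _ _ _ ua (unfactorizable_isor isoh ub)
  (etrans e (esym (compA _ _ _))).
have ezz := skC _ _ _ isok; case: isok => k' kK.
move: k k' kK b q ub uq e kabh qk; subst z' => k k' kK b q ub uq e kabh qk.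
apply: (@related_cons _ _ _ _ _ (Aut kK)); last exact: IH.
by rewrite /= kabh -compA (aut_inverse h).2 compm1.
Qed.

(** * Cancellation in generated categories *)

Section GeneratedCancellation.
Variable Q : EIquiver.
Let D := generated_category Q.

Fixpoint path_length (v w : Q) (p : qpath v w) : nat :=
  match p with
  | path_arrow _ => 1
  | path_cons _ _ p => (path_length p).+1
  end.

Definition qlength (v w : Q) (m : qhom v w) : nat :=
  match m with
  | qend _ _ => 0
  | qpth _ _ p _ => path_length p
  end.

Lemma path_length_gt0 (v w : Q) (p : qpath v w) : 0 < path_length p.
Proof. by case: p. Qed.

Lemma path_length_cat (u v w : Q) (p2 : qpath v w) (p1 : qpath u v) :
  path_length (path_cat p2 p1) = path_length p2 + path_length p1.
Proof. by elim: p2 p1 => [al|al v' p2 IH] p1 //=; rewrite IH. Qed.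

Lemma qlength_comp (u v w : Q) (b : qhom v w) (a : qhom u v) :
  qlength (qcomp b a) = qlength b + qlength a.
Proof.
case: b a => [{}v k|{}v {}w p2 y] a.
  by case: a k.
case: a p2 y => [{}v l|{}u {}v p1 x] p2 y /=; first by rewrite addn0.
exact: path_length_cat.
Qed.

Lemma qend_iso (v : Q) (k : vgroup v) : @is_iso D v v (qend k).
Proof.
by exists (qend k^-1%g); split; rewrite /= ?mulVg ?mulgV.
Qed.

Lemma iso_qlength (v w : Q) (m : @hom D v w) : is_iso m <-> qlength m = 0.
Proof.
split=> [[n [nm _]]|].
  by have := congr1 (@qlength v v) nm; rewrite qlength_comp => /eqP;
    rewrite addn_eq0 => /andP[_ /eqP].
case: m => [{}v k _|{}v {}w p x /= p0]; first exact: qend_iso.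
by have := path_length_gt0 p; rewrite p0.
Qed.

Definition qatom (al : arrow Q) (x : abiset al) : qhom (src al) (tgt al) :=
  qpth (p := path_arrow al) x.

(* Morphisms out of [v] packed with their target, which differs for the two sides
   when last arrows are compared. *)
Definition cone (v : Q) := {w : Q & qhom v w}.

Definition cone_comp (u v : Q) (M : cone v) (a : qhom u v) : cone u :=
  existT _ (tag M) (qcomp (tagged M) a).

Definition cone_end (v : Q) (k : vgroup v) : cone v := existT _ v (qend k).

Definition cone_cons (v : Q) (al : arrow Q) (x : abiset al)
    (m : qhom v (src al)) : cone v :=
  existT _ (tgt al) (qcomp (qatom x) m).

Definition cone_length (v : Q) (M : cone v) := qlength (tagged M).

Lemma cone_length_comp (u v : Q) (M : cone v) (a : qhom u v) :
  cone_length (cone_comp M a) = cone_length M + qlength a.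
Proof. exact: qlength_comp. Qed.

Lemma cone_cons_comp (u v : Q) (al : arrow Q) (x : abiset al)
    (m : qhom v (src al)) (a : qhom u v) :
  cone_comp (cone_cons x m) a = cone_cons x (qcomp m a).
Proof. by rewrite /cone_comp /cone_cons qcompA. Qed.

Lemma cone_length_cons (v : Q) (al : arrow Q) (x : abiset al)
    (m : qhom v (src al)) : cone_length (cone_cons x m) = (qlength m).+1.
Proof. exact: qlength_comp. Qed.

(** Splits off the last arrow; a path of length one fits the second case as an arrow composed with
    an identity. *)
Lemma cone_case (v : Q) (P : cone v -> Prop) :
  (forall k, P (cone_end k)) ->
  (forall al x (m : qhom v (src al)), P (cone_cons x m)) ->
  forall M, P M.
Proof.
move=> Pend Pcons [w m]; case: m P Pend Pcons => {v w} [v k|v w p x] P Pend Pcons.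
  exact: Pend.
case: p x P Pend Pcons => [al|al v' p] x P Pend Pcons.
  have := Pcons _ x (qid (src al)).
  by rewrite /cone_cons qcompm1.
elim/bclass_ind: x => x y; exact: (Pcons _ x (qpth y)).
Qed.

(** Being a function of the whole cone, it turns an equality of cones into an equality of last
    arrows, labels and remainders. *)
Definition last_arrow (v : Q) (M : cone v) :
    option {al : arrow Q & (abiset al * qhom v (src al))%type} :=
  match tagged M with
  | qend _ _ => None
  | qpth _ _ p x =>
    match p as p' in qpath v w return path_biset p' ->
      option {al : arrow Q & (abiset al * qhom v (src al))%type} with
    | path_arrow al => fun x => Some (existT _ al (x, qid (src al)))
    | path_cons al v p => fun x : bprod (abiset al) (path_biset p) =>
        Some (existT _ al ((repr x).1, qpth (repr x).2))
    end x
  end.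

(* [k] is the ambiguity in the representatives chosen by [last_arrow]. *)
Lemma last_arrow_cons (v : Q) (al : arrow Q) (x : abiset al)
    (m : qhom v (src al)) :
  exists k : vgroup (src al),
    last_arrow (cone_cons x m) =
      Some (existT _ al (ract x k, qcomp (qend k^-1%g) m)).
Proof.
(* The target [src al] is not a variable, so it is generalized through a cast before [m] is
   analyzed. *)
suff gen u (m' : qhom v u) (e : u = src al) :
    exists k : vgroup (src al),
      last_arrow (cone_cons x (ecast u (qhom v u) e m')) =
        Some (existT _ al (ract x k, qcomp (qend k^-1%g) (ecast u (qhom v u) e m'))).
  exact: (gen _ m erefl).
case: m' e {m} => {v u} [v l|v w p y] e; subst.
  by exists l; rewrite /= mulVg.
have [k [e1 e2]] := (bclassP _ _ _ _).1 (bclass_repr (bclass x y)).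
exists k; rewrite /last_arrow /= e1.
by rewrite {2}e2 -lactM mulVg lact1.
Qed.

(** Applying [last_arrow] to both sides gives [al = be], and the two ambiguities [k] and [l] combine
    into [l k^-1]. *)
Lemma cone_cons_inj (v : Q) (al be : arrow Q) (x : abiset al) (y : abiset be)
    (m : qhom v (src al)) (n : qhom v (src be)) :
  cone_cons x m = cone_cons y n ->
  exists k : @hom D (src al) (src be),
    [/\ is_iso k, qcomp k m = n & cone_cons y k = existT _ _ (qatom x)].
Proof.
move=> e; have [k ek] := last_arrow_cons x m; have [l el] := last_arrow_cons y n.
rewrite e el in ek; have /= ebe := congr1 tag (Some_inj ek).
subst be; have e23 := inj_pair2 _ _ _ _ _ (Some_inj ek).
have e2 : ract y l = ract x k := congr1 fst e23.
have e3 : qcomp (qend l^-1%g) n = qcomp (qend k^-1%g) m := congr1 snd e23.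
exists (qend (l * k^-1)%g); split; first exact: qend_iso.
  rewrite -[qend _]/(qcomp (qend l) (qend k^-1%g)) -qcompA -e3 qcompA /= mulgV.
  exact: qcomp1m.
by rewrite /cone_cons /= ractM e2 -ractM mulgV ract1.
Qed.

(** Induction on the length of [M], which equals that of [N] by additivity. In length 0 both are
    automorphisms; otherwise [cone_cons_inj] matches the last arrows up to an isomorphism [k], and
    the induction hypothesis is applied to [k m] and [n']. *)
Lemma cone_cancel (x z z' : Q) (M : cone z) (N : cone z')
    (a : qhom x z) (b : qhom x z') :
  qlength a = qlength b -> cone_comp M a = cone_comp N b ->
  exists k : @hom D z z', [/\ is_iso k, qcomp k a = b & cone_comp N k = M].
Proof.
move=> lab; have [n] := ubnP (cone_length M).
elim: n => // n IH in z z' M N a b lab *; move=> ltMn eMN.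
have lMN : cone_length M = cone_length N.
  apply: (@addIn (qlength a)).
  by rewrite {2}lab -!cone_length_comp eMN.
elim/cone_case: M ltMn eMN lMN => [k|al u m] ltMn eMN lMN.
  elim/cone_case: N eMN lMN => [l|be v n'] eMN; rewrite ?cone_length_cons // => _.
  have ez : z = z' := congr1 (@tag _ _) eMN.
  subst z'; have ekl := inj_pair2 _ _ _ _ _ eMN.
  exists (qend (l^-1 * k)%g); split; first exact: qend_iso.
    rewrite -[qend _]/(qcomp (qend l^-1%g) (qend k)) -qcompA ekl qcompA /= mulVg.
    exact: qcomp1m.
  by rewrite /cone_comp /= mulgA mulgV mul1g.
elim/cone_case: N eMN lMN => [l|be v n'] eMN; rewrite !cone_length_cons // => _.
have [k [isok kma yk]] : exists k : @hom D (src al) (src be),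
    [/\ is_iso k, qcomp k (qcomp m a) = qcomp n' b &
        cone_cons v k = existT _ _ (qatom u)].
  by apply: cone_cons_inj; rewrite -!cone_cons_comp.
have [] := IH _ _ (existT _ _ (qcomp k m)) (existT _ _ n') a b lab.
- move: ltMn; rewrite cone_length_cons ltnS /cone_length qlength_comp.
  by have /iso_qlength -> := isok.
- by rewrite /cone_comp /= -qcompA kma.
move=> l [isol la nl]; exists l; split=> //.
have {}nl := inj_pair2 _ _ _ _ _ nl.
rewrite cone_cons_comp nl -cone_cons_comp.
exact: (congr1 (fun M => cone_comp M m) yk).
Qed.

Lemma unfactorizable_qlength (v w : Q) (a : @hom D v w) :
  unfactorizable a -> qlength a = 1.
Proof.
move=> [nisoa ua].
(* Unfactorizability is restated for cones to make [cone_case] applicable. Splitting [a] as an arrow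
   after [m] forces [m] to have length 0, as the arrow has length 1. *)
pose P (M : cone v) := (qlength (tagged M) <> 0) ->
  (forall (z : D) (c : @hom D z (tag M)) (b : @hom D v z),
    tagged M = comp c b -> is_iso b \/ is_iso c) -> cone_length M = 1.
suff : P (existT _ w a) by apply=> // /iso_qlength.
elim/cone_case: (existT _ w a) => [k|al x m] //= _ /(_ _ _ _ erefl)[].
  by rewrite iso_qlength cone_length_cons => ->.
by rewrite iso_qlength.
Qed.

Lemma generated_head_cancellation : head_cancellation D.
Proof.
move=> x z z' y a b c d /unfactorizable_qlength la /unfactorizable_qlength lb e.
have [||k [isok ka dk]] :=
    @cone_cancel x z z' (existT _ y c) (existT _ y d) a b.
- by rewrite la lb.
- by rewrite /cone_comp /= [qcomp c a]e.
by exists k; split=> //; apply: inj_pair2 dk.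
Qed.

End GeneratedCancellation.

(** * Transport along isomorphisms of categories *)

Section Transport.
Variables (C D : category).

Lemma isomorphic_functor :
  isomorphic_categories C D ->
  exists F : functor C D,
    [/\ forall z : D, exists z' : C, F z' = z,
        forall (x y : C) (a b : hom x y), fmap F a = fmap F b -> a = b &
        forall (x y : C) (m : hom (F x) (F y)), exists a, fmap F a = m].
Proof.
move=> [F [G [GF FG]]]; exists F; split=> [z|x y a b eab|x y m].
- by exists (G z); apply: (congr1 (@dom D) (FG _ _ (idm z))).
- by apply: Mor_inj; rewrite -GF eab GF.
(* [G (F x)] is only propositionally equal to [x], so the preimage is first considered with free
   endpoints. *)
have lift x' y' (a : hom x' y') : x' = x -> y' = y ->
    Mor (fmap F a) = Mor m -> exists a', fmap F a' = m.
  by move=> ? ?; subst x' y' => /Mor_inj <-; exists a.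
apply: (lift _ _ (fmap G m)) => //.
  exact: (congr1 (@dom C) (GF _ _ (idm x))).
exact: (congr1 (@dom C) (GF _ _ (idm y))).
Qed.

Lemma head_cancellation_isomorphic :
  isomorphic_categories C D -> head_cancellation D -> head_cancellation C.
Proof.
move=> /isomorphic_functor[F [surF faithF fullF]] hc.
have isoF (x y : C) (a : hom x y) : is_iso (fmap F a) <-> is_iso a.
  split=> [[b' [ba ab]]|[b [ba ab]]].
    have [b eb] := fullF _ _ b'; rewrite -eb in ba ab.
    by exists b; split; apply: faithF; rewrite fmap_comp fmap_id.
  by exists (fmap F b); split; rewrite -fmap_comp ?ba ?ab fmap_id.
(* A factorization of [fmap F a] pulls back to one of [a]: surjectivity on objects supplies the
   middle object, fullness the factors. *)
have unfF (x y : C) (a : hom x y) : unfactorizable a -> unfactorizable (fmap F a).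
  move=> [nisoa ua]; split; first by rewrite isoF.
  move=> z c b; have [z' ez] := surF z; subst z.
  have [c' <-] := fullF _ _ c; have [b' <-] := fullF _ _ b.
  by rewrite -fmap_comp => /faithF /ua; rewrite !isoF.
move=> x z z' y a b c d /unfF ua /unfF ub e.
have [|k' [isok]] := hc _ _ _ _ _ _ (fmap F c) (fmap F d) ua ub.
  by rewrite -!fmap_comp e.
have [k ek] := fullF _ _ k'; subst k'; rewrite -!fmap_comp => /faithF kab /faithF dk.
by exists k; split=> //; apply/isoF.
Qed.

End Transport.

(** * The quiver of unfactorizable morphisms *)

Section ChainCat.
Variable C : category.

Fixpoint chain_cat (x y z : C) (p : chain x y) : chain y z -> chain x z :=
  match p in chain x y return chain y z -> chain x z with
  | chain_nil _ => fun q => q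
  | chain_cons _ _ _ a p => fun q => chain_cons a (chain_cat p q)
  end.

Lemma composite_cat (x y z : C) (p : chain x y) (q : chain y z) :
  composite (chain_cat p q) = comp (composite q) (composite p).
Proof.
elim: p q => {x y} [x|x w y a p IH] q /=; first by rewrite compm1.
by rewrite IH compA.
Qed.

Lemma all_unfactorizable_cat (x y z : C) (p : chain x y) (q : chain y z) :
  all_unfactorizable p -> all_unfactorizable q ->
  all_unfactorizable (chain_cat p q).
Proof.
by elim: p q => {x y} [x|x w y a p IH] q //= [ua up] uq; split=> //; apply: IH.
Qed.

End ChainCat.

Lemma finite_set_enum (T : Type) : finite_set [set: T] ->
  {s : seq {classic T} | forall x, x \in s}.
Proof.
move=> finT; apply: cid.
have /finite_seqP[s es] : finite_set [set: {classic T}] by [].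
by exists s => x; have : [set` s]%classic x by rewrite -es.
Qed.

Section FinTypeOf.
Variables (T : Type) (finT : finite_set [set: T]).

Let index_of (x : T) : seq_sub (sval (finite_set_enum finT)) :=
  SeqSub (svalP (finite_set_enum finT) x).

Fact index_ofK : cancel index_of (fun i => val i : T).
Proof. by []. Qed.

(** Its carrier is convertible to [T], so that elements of [fhom x y] below serve directly as
    morphisms. *)
Definition finType_of : finType := can_type index_ofK.

End FinTypeOf.

(** * Functors out of a generated category *)

Section GeneratedFunctor.
Variables (Q : EIquiver) (C : category) (o : Q -> C).
Variable phi : forall v : Q, vgroup v -> hom (o v) (o v).
Variable psi : forall al : arrow Q, abiset al -> hom (o (src al)) (o (tgt al)).
Arguments psi {al} _.
Hypothesis phi1 : forall v : Q, phi (1%g : vgroup v) = idm (o v).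
Hypothesis phiM : forall (v : Q) (k l : vgroup v),
  phi (k * l)%g = comp (phi k) (phi l).
Hypothesis psi_lact : forall (al : arrow Q) (k : vgroup (tgt al)) (x : abiset al),
  psi (lact k x) = comp (phi k) (psi x).
Hypothesis psi_ract : forall (al : arrow Q) (x : abiset al) (k : vgroup (src al)),
  psi (ract x k) = comp (psi x) (phi k).

Fixpoint path_eval (v w : Q) (p : qpath v w) : path_biset p -> hom (o v) (o w) :=
  match p in qpath v w return path_biset p -> hom (o v) (o w) with
  | path_arrow al => fun x : abiset al => psi x
  | path_cons al v p => fun x : bprod (abiset al) (path_biset p) =>
      comp (psi (repr x).1) (path_eval (repr x).2)
  end.

Lemma path_eval_lact (v w : Q) (p : qpath v w) (k : vgroup w) (x : path_biset p) :
  path_eval (lact k x) = comp (phi k) (path_eval x).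
Proof.
elim: p k x => [al|al u p IH] k x /=; first exact: psi_lact.
have [l [-> e2]] := (bclassP _ _ _ _).1 (bclass_repr (bprod_lact k x)).
by rewrite [in RHS]e2 IH psi_ract psi_lact !compA.
Qed.

(** Independence of the representative chosen in [path_eval]: the element [k] relating two
    representatives moves across the composite by equivariance of [psi] and [path_eval]. *)
Lemma path_eval_cons (v : Q) (al : arrow Q) (p : qpath v (src al)) (x : abiset al)
    (y : path_biset p) :
  path_eval (p := path_cons al p) (bclass x y) = comp (psi x) (path_eval y).
Proof.
have [k [e1 e2]] := (bclassP _ _ _ _).1 (bclass_repr (bclass x y)).
by rewrite /= e1 [in RHS]e2 path_eval_lact psi_ract compA.
Qed.

Lemma path_eval_ract (v w : Q) (p : qpath v w) (x : path_biset p) (k : vgroup v) :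
  path_eval (ract x k) = comp (path_eval x) (phi k).
Proof.
elim: p x k => [al|al u p IH] x k; first exact: psi_ract.
elim/bclass_ind: x => x y.
by rewrite [ract _ _]bprod_ractE !path_eval_cons IH compA.
Qed.

Lemma path_eval_mul (u v w : Q) (p2 : qpath v w) (p1 : qpath u v)
    (y : path_biset p2) (x : path_biset p1) :
  path_eval (path_mul y x) = comp (path_eval y) (path_eval x).
Proof.
elim: p2 p1 y x => [al|al v' p2 IH] p1 y x; first exact: path_eval_cons.
elim/bclass_ind: y => y z.
by rewrite path_mulE !path_eval_cons IH compA.
Qed.

Definition eval (v w : Q) (m : qhom v w) : hom (o v) (o w) :=
  match m in qhom v w return hom (o v) (o w) with
  | qend v k => phi k
  | qpth _ _ p x => path_eval x
  end.

Lemma eval_comp (u v w : Q) (b : qhom v w) (a : qhom u v) :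
  eval (qcomp b a) = comp (eval b) (eval a).
Proof.
case: b a => [{}v k|{}v {}w p2 y] a.
  case: a k => [{}v l|{}u {}v p x] k /=; first exact: phiM.
  exact: path_eval_lact.
case: a p2 y => [{}v l|{}u {}v p1 x] p2 y /=; first exact: path_eval_ract.
exact: path_eval_mul.
Qed.

Definition eval_functor : functor (generated_category Q) C :=
  @Functor (generated_category Q) C o eval phi1
    (fun x y z b a => eval_comp b a).

End GeneratedFunctor.

Section FiniteCategory.
Variables (C : category) (finC : finite_category C).

Lemma finite_obj : finite_set [set: C].
Proof.
apply: sub_finite_set (finite_image (@dom C) finC) => x _.
by exists (Mor (idm x)).
Qed.

Lemma finite_hom (x y : C) : finite_set [set: hom x y].
Proof.
suff -> : [set: hom x y]%classic = (@Mor C x y @^-1` [set: mor C])%classic by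
  apply: finite_preimage finC => a b _ _; apply: Mor_inj.
by rewrite preimage_setT.
Qed.

Definition fobjs : finType := finType_of finite_obj.
Definition fhom (x y : C) : finType := finType_of (finite_hom x y).

Hypothesis EI : forall (x : C) (a : hom x x), is_iso a.

Lemma unfactorizable_decomposition_exists (x y : C) (a : hom x y) :
  ~ is_iso a -> exists p, unfactorizable_decomposition a p.
Proof.
(* Both factors of a factorization into non-isomorphisms have strictly fewer
   objects between their endpoints. *)
pose between (x y : C) :=
  [set z : fobjs | `[< inhabited (hom x z) /\ inhabited (hom z y) >]].
have betweenP u v w : w \in between u v <-> inhabited (hom u w) /\ inhabited (hom w v).
  by split=> [|H]; rewrite inE; [apply: asboolW|apply: asboolT].
have [n] := ubnP #|between x y|; elim: n => // n IH in x y a *.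
rewrite ltnS => len nisoa.
have [ua|nua] := pselect (unfactorizable a).
  by exists (chain_cons a (chain_nil y)); split=> //=; rewrite comp1m.
have [z [c [b [eab nisob nisoc]]]] : exists z (c : hom z y) (b : hom x z),
    [/\ a = comp c b, ~ is_iso b & ~ is_iso c].
  apply: contrapT => nex; apply: nua; split=> // z c b eab.
  have [|nb] := pselect (is_iso b); first by left.
  have [|nc] := pselect (is_iso c); first by right.
  by case: nex; exists z, c, b.
have [||p [up ep]] := IH x z b => //.
  apply: leq_trans len; apply: proper_card; apply/properP; split.
    apply/fintype.subsetP => u /betweenP[xu [d]]; apply/betweenP.
    by split=> //; exists; apply: comp c d.
  (* [y] is lost on passing to [between x z]: a morphism from [y] to [z] would make [c] an
     isomorphism. *)
  exists (y : fobjs).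
    by apply/betweenP; split; exists; [apply: a|apply: idm].
  by apply/negP => /betweenP[_ [d]]; apply: nisoc; apply: (EI_split_mono EI c d).
have [||q [uq eq]] := IH z y c => //.
  apply: leq_trans len; apply: proper_card; apply/properP; split.
    apply/fintype.subsetP => u /betweenP[[d] uy]; apply/betweenP.
    by split=> //; exists; apply: comp d b.
  exists (x : fobjs).
    by apply/betweenP; split; exists; [apply: idm|apply: a].
  by apply/negP => /betweenP[[d] _]; apply: nisob; apply: (EI_split_mono EI b d).
exists (chain_cat p q); split; first exact: all_unfactorizable_cat.
by rewrite composite_cat ep eq.
Qed.

Section EndGroup.
Variable x : C.

Let mul (b a : fhom x x) : fhom x x := comp (b : hom x x) a.
Let inv (a : fhom x x) : fhom x x := sval (cid (EI a)).

Fact end_mulA : associative mul.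
Proof. by move=> a b c; apply: compA. Qed.

Fact end_mul1 : left_id (idm x : fhom x x) mul.
Proof. by move=> a; apply: comp1m. Qed.

Fact end_mulV : left_inverse (idm x : fhom x x) inv mul.
Proof. by move=> a; case: (svalP (cid (EI a))). Qed.

Definition end_group : finGroupType :=
  HB.pack (Finite.sort (fhom x x)) (Finite_isGroup.Build _ end_mulA end_mul1 end_mulV).

End EndGroup.

Section UnfactorizableBiset.
Variables x y : C.

Definition unf : finType :=
  {a : fhom x y | `[< unfactorizable (a : hom x y) >]}.

Definition unf_arr (a : unf) : hom x y := val a.

Definition Unf (a : hom x y) (ua : unfactorizable a) : unf :=
  exist _ (a : fhom x y) (asboolT ua).

Lemma unf_arrP (a : unf) : unfactorizable (unf_arr a).
Proof. exact: asboolW (valP a). Qed.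

Lemma unf_arr_inj : injective unf_arr.
Proof. exact: val_inj. Qed.

Definition unf_lact (k : end_group y) (a : unf) : unf :=
  Unf (unfactorizable_isol (EI (k : hom y y)) (unf_arrP a)).

Definition unf_ract (a : unf) (k : end_group x) : unf :=
  Unf (unfactorizable_isor (EI (k : hom x x)) (unf_arrP a)).

Fact unf_lact1 a : unf_lact 1%g a = a.
Proof. by apply: unf_arr_inj; apply: comp1m. Qed.

Fact unf_lactM k l a : unf_lact (k * l)%g a = unf_lact k (unf_lact l a).
Proof. by apply: unf_arr_inj; apply: esym (compA _ _ _). Qed.

Fact unf_ract1 a : unf_ract a 1%g = a.
Proof. by apply: unf_arr_inj; apply: compm1. Qed.

Fact unf_ractM a k l : unf_ract a (k * l)%g = unf_ract (unf_ract a k) l.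
Proof. by apply: unf_arr_inj; apply: compA. Qed.

Fact unf_lractA k a l : unf_lact k (unf_ract a l) = unf_ract (unf_lact k a) l.
Proof. by apply: unf_arr_inj; apply: compA. Qed.

Definition unf_biset : biset (end_group y) (end_group x) :=
  Biset unf_lact1 unf_lactM unf_ract1 unf_ractM unf_lractA.

End UnfactorizableBiset.

(** Only pairs with a nonempty biset become arrows. Every path is then realized by a non-isomorphism
    of [C], so a closed path would contradict the EI property. *)
Definition unf_pair : finType :=
  {e : fobjs * fobjs | `[< exists a : hom (e.1 : C) (e.2 : C), unfactorizable a >]}.

Definition unf_quiver : quiver :=
  @Quiver fobjs unf_pair (fun e => (val e).1) (fun e => (val e).2).

Lemma unf_qpath (v w : unf_quiver) (p : qpath v w) :
  exists a : hom (v : C) w, ~ is_iso a.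
Proof.
elim: p => [al|al u p [b nisob]].
  by have [a [nisoa _]] := asboolW (valP al); exists a.
have [a [nisoa _]] := asboolW (valP al); exists (comp (a : hom (src al : C) _) b).
by move=> /(iso_comp_EI EI)[].
Qed.

Lemma unf_quiver_acyclic : acyclic unf_quiver.
Proof. by move=> v /unf_qpath[a]; case; apply: EI. Qed.

Definition unf_EIquiver : EIquiver :=
  @EIQuiver unf_quiver (fun v => end_group v) (fun al => unf_biset (src al) (tgt al))
    unf_quiver_acyclic.
Local Notation Q := unf_EIquiver.
Local Notation D := (generated_category Q).

Definition evaluation : functor D C :=
  @eval_functor Q C (fun v => v) (fun v k => k) (fun al x => unf_arr x)
    (fun v => erefl) (fun v k l => erefl) (fun al k x => erefl) (fun al x k => erefl).
Local Notation qeval := (fmap evaluation).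

(** * Lifting chains to the generated category *)

Definition unf_arrow (x y : C) (a : hom x y) (ua : unfactorizable a) : arrow Q :=
  exist _ (x : fobjs, y : fobjs) (asboolT (ex_intro _ a ua)).

Definition unf_qhom (x y : C) (a : hom x y) (ua : unfactorizable a) : @hom D x y :=
  @qatom Q (unf_arrow ua) (Unf ua).

(** An arrow of the quiver contains a proof that its biset is nonempty; proof irrelevance removes
    the dependence on it. *)
Lemma qatom_irrelevance (x y : fobjs)
    (H H' : `[< exists a : hom (x : C) (y : C), unfactorizable a >]) (u v : unf x y) :
  unf_arr u = unf_arr v ->
  @qatom Q (exist _ (x, y) H) u = @qatom Q (exist _ (x, y) H') v :> qhom (x : Q) (y : Q).
Proof. by move=> /unf_arr_inj ->; rewrite (Prop_irrelevance H H'). Qed.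

Lemma unf_qhom_arr (al : arrow Q) (u : abiset al) (ua : unfactorizable (unf_arr u)) :
  unf_qhom ua = qatom u.
Proof. by case: al u ua => -[x y] H u ua; apply: qatom_irrelevance. Qed.

Lemma unf_qhom_aut (x y : C) (a b : hom x y) (ua : unfactorizable a)
    (ub : unfactorizable b) (h : end_group x) (k : end_group y) :
  comp b (h : hom x x) = comp (k : hom y y) a ->
  comp (unf_qhom ub) (qend (h : @vgroup Q x) : @hom D x x) =
    comp (qend (k : @vgroup Q y) : @hom D y y) (unf_qhom ua).
Proof.
move=> e; apply: (@qatom_irrelevance _ _ _ _ (unf_ract (Unf ub) h) (unf_lact k (Unf ua))).
exact: e.
Qed.

Fixpoint lift_chain (x y : C) (p : chain x y) :
    all_unfactorizable p -> @hom D x y :=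
  match p in chain x y return all_unfactorizable p -> @hom D x y with
  | chain_nil x => fun _ => idm (x : D)
  | chain_cons _ _ _ a p => fun H => comp (lift_chain (proj2 H)) (unf_qhom (proj1 H))
  end.

Lemma qeval_lift (x y : C) (p : chain x y) (up : all_unfactorizable p) :
  qeval (lift_chain up) = composite p.
Proof.
elim: p up => {x y} [x|x z y a p IH] up; first by [].
rewrite -[RHS]/(comp (composite p) a) -(IH (proj2 up)).
exact: (fmap_comp evaluation (lift_chain (proj2 up)) (unf_qhom (proj1 up))).
Qed.

Lemma lift_chain_cat (x y z : C) (p : chain x y) (q : chain y z)
    (up : all_unfactorizable p) (uq : all_unfactorizable q)
    (upq : all_unfactorizable (chain_cat p q)) :
  lift_chain upq = comp (lift_chain uq) (lift_chain up).
Proof.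
elim: p q up uq upq => {x y} [x|x w y a p IH] q up uq upq /=.
  by rewrite qcompm1 (Prop_irrelevance upq uq).
rewrite (IH q (proj2 up) uq (proj2 upq)) qcompA.
congr (qcomp _ (unf_qhom _)); exact: Prop_irrelevance.
Qed.

Lemma lift_chain1 (x y : C) (a : hom x y) (ua : unfactorizable a)
    (uc : all_unfactorizable (chain_cons a (chain_nil y))) :
  lift_chain uc = unf_qhom ua.
Proof. by rewrite (Prop_irrelevance ua (proj1 uc)); apply: qcomp1m. Qed.

(** Representatives of the iterated biset product, one label per arrow, form the chain. *)
Lemma lift_chain_surj (x y : Q) (p : qpath x y) (u : path_biset p) :
  exists (c : chain (x : C) y) (uc : all_unfactorizable c), lift_chain uc = qpth u.
Proof.
pose atomc (al : arrow Q) (v : abiset al) :=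
  chain_cons (unf_arr v) (chain_nil (tgt al : C)).
have atomP al v : exists uc : all_unfactorizable (@atomc al v), lift_chain uc = qatom v.
  exists (conj (unf_arrP v) I).
  exact: etrans (lift_chain1 (unf_arrP v) _) (unf_qhom_arr (unf_arrP v)).
elim: p u => [al|al v p IH] u.
  by have [uc e] := atomP al u; exists (atomc al u), uc.
elim/bclass_ind: u => u w; have [c [uc ec]] := IH w.
have [ua ea] := atomP al u.
exists (chain_cat c (atomc al u)), (all_unfactorizable_cat uc ua).
by rewrite (lift_chain_cat uc ua) ec ea.
Qed.

(** The relation [b_i h_(i-1) = h_i a_i] also holds between lifted arrows, so the automorphism
    travels along the chain until it reaches [h_n = 1]. *)
Lemma lift_chain_related (x y : C) (h : aut x) (p q : chain x y)
    (up : all_unfactorizable p) (uq : all_unfactorizable q) :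
  aut_related h p q ->
  comp (lift_chain uq) (qend ((h : hom x x) : @vgroup Q x) : @hom D x x) = lift_chain up.
Proof.
move=> r; elim: r up uq => {x y h p q} [x h h1|x z y h k a b p q eb _ IH] up uq /=.
  by rewrite h1; apply: (@qcomp1m Q x x (@qid Q x)).
rewrite -(IH (proj2 up) (proj2 uq)) -!qcompA; congr qcomp.
apply: unf_qhom_aut.
by rewrite eb -[LHS]compA (aut_inverse h).1 compm1.
Qed.

(** * Evaluation is an isomorphism under the UFP *)

Hypothesis skC : skeletal C.
Hypothesis ufp : UFP C.

(** Endomorphisms are just group elements, by acyclicity. For [x <> y] both morphisms lift chains
    with equal composite, a non-isomorphism by skeletality, and the UFP relates these chains. *)
Lemma qeval_inj (x y : C) : injective (@fmap _ _ evaluation x y).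
Proof.
move=> m m' em; have [exy|nxy] := pselect (x = y).
  move: m m' em; rewrite -exy => m m'.
  have [k ->] := qhom_diag m; have [k' ->] := qhom_diag m'.
  by move=> e; congr qend; apply: e.
have [p [u eu]] := qhom_offdiag m nxy; have [p' [u' eu']] := qhom_offdiag m' nxy.
have [c [uc ec]] := lift_chain_surj u; have [c' [uc' ec']] := lift_chain_surj u'.
rewrite eu eu' -ec -ec' in em *; rewrite !qeval_lift in em.
suff rel : aut_related (aut1 x) c c'.
  apply: etrans (esym (lift_chain_related uc uc' rel)) _.
  exact: (@compm1 D x y (lift_chain uc')).
by apply: (ufp (a := composite c)) => // /skC.
Qed.

Lemma qeval_surj (x y : C) (a : hom x y) :
  exists m : @hom D x y, fmap evaluation m = a.
Proof.
have [isoa|nisoa] := pselect (is_iso a).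
  have exy := skC isoa; subst y.
  by exists (qend (a : @vgroup Q x)).
have [p [up <-]] := unfactorizable_decomposition_exists nisoa.
by exists (lift_chain up); apply: qeval_lift.
Qed.

Lemma UFP_isomorphic : isomorphic_categories C D.
Proof.
(* The inverse functor picks preimages; its functor laws follow from injectivity of evaluation. *)
pose g (x y : C) (a : hom x y) : @hom D x y := sval (cid (qeval_surj a)).
have gK (x y : C) (a : hom x y) : fmap evaluation (g x y a) = a.
  exact: svalP (cid (qeval_surj a)).
have g1 (x : C) : g x x (idm x) = idm (x : D).
  by apply: qeval_inj; rewrite gK (fmap_id evaluation).
have gM (x y z : C) (b : hom y z) (a : hom x y) :
    g x z (comp b a) = comp (g y z b) (g x y a).
  by apply: qeval_inj; rewrite gK (fmap_comp evaluation) !gK.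
exists (@Functor C D id g g1 gM), evaluation; split=> x y a; congr Mor.
  exact: gK.
by apply: qeval_inj; rewrite gK.
Qed.

End FiniteCategory.

Theorem proposition2p8 (C : category) :
  connected_category C -> skeletal C -> finite_EI_category C ->
  (finite_free_EI_category C <-> UFP C).
Proof.
move=> _ skC feiC; have [finC EI] := feiC; split=> [[_ [Q isoQ]]|ufp].
  apply: head_cancellation_UFP skC EI _.
  exact: head_cancellation_isomorphic isoQ (@generated_head_cancellation Q).
split=> //; exists (unf_EIquiver finC EI); exact: UFP_isomorphic skC ufp.
Qed.
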